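(* Let $p$ be an odd prime, $m$ a positive even integer, $s=m/2$, $q=p^m$, $u$ a positive integer and $v=\gcd(m,u)$. Let $\mathrm{Tr}$ denote the trace map from $\mathbb{F}_q$ to $\mathbb{F}_p$. Let \[ D_1=\{(x,y)\in\mathbb{F}_q^2\setminus\{(0,0)\} : \mathrm{Tr}(x+y^{p^u+1})=0\}, \] and $C_{D_1}=\{c(a,b)=(\mathrm{Tr}(ax+by))_{(x,y)\in D_1} : a,b\in\mathbb{F}_q\}$. If $\frac{m}{v}\equiv 2\pmod 4$, then $C_{D_1}$ is a $[p^{2m-1}-1,2m]$ three-weight linear code over $\mathbb{F}_p$ whose weight distribution is: weight $0$ with multiplicity $1$; weight $(p-1)p^{2m-2}$ with multiplicity $p^{2m}-1-(p-1)p^m$; weight $(p-1)p^{2m-2}\left(1+\frac{1}{p^s}\right)$ with multiplicity $(p-1)(p^{m-1}-p^s+p^{s-1})$; and weight $(p-1)p^{2m-2}\left(1-\frac{1}{(p-1)p^s}\right)$ with multiplicity $(p-1)(p^s+1)(p^s-p^{s-1})$.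
   Context: An $[n,k]$ linear code over $\mathbb{F}_p$ is a $k$-dimensional subspace of $\mathbb{F}_p^n$. The multiplicity of a weight $w$ is the number of codewords of Hamming weight $w$; a code is $t$-weight if exactly $t$ nonzero weights occur. *)

(* Defs.v *)
From mathcomp Require Import all_boot all_order all_algebra all_field.
Set Implicit Arguments. Unset Strict Implicit. Unset Printing Implicit Defensive.
Import GRing.Theory.
Local Open Scope ring_scope.

(* Absolute trace F_{p^m} -> F_p, valued in the prime subfield of F. *)
Definition Tr {F : finFieldType} (p m : nat) (x : F) : F :=
  \sum_(i < m) x ^+ (p ^ i).

Definition D1 (F : finFieldType) (p m u : nat) : {set F * F} :=
  [set z : F * F | (z != (0, 0)) && (Tr p m (z.1 + z.2 ^+ (p ^ u).+1) == 0)].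

(* Codeword c(a,b) = (Tr(ax+by))_{(x,y) in D_1}; coordinates outside D_1 are
   set to 0 and are not coordinates of the code. *)
Definition cw {F : finFieldType} (p m u : nat) (a b : F) : {ffun F * F -> F} :=
  [ffun z : F * F => if z \in D1 F p m u then Tr p m (a * z.1 + b * z.2) else 0].

Definition code {F : finFieldType} (p m u : nat) : {set {ffun F * F -> F}} :=
  [set cw p m u ab.1 ab.2 | ab : F * F].

Definition wt {F : finFieldType} (p m u : nat) (c : {ffun F * F -> F}) : nat :=
  #|[set z in D1 F p m u | c z != 0]|.

Definition mult {F : finFieldType} (p m u : nat) (w : nat) : nat :=
  #|[set c in code (F:=F) p m u | wt (F:=F) p m u c == w]|.

(* Main.v *)
Require Import Defs.
From mathcomp Require Import all_boot all_order all_algebra all_field.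
From mathcomp Require Import zify ring.
Import GRing.Theory Num.Theory.
Local Open Scope ring_scope.

(* The codeword c(a,b) vanishes at (x,y) in D_1 iff Tr x = - Q(y) and
   Tr(ax + by) = 0, where Q(y) = Tr(y^(p^u+1)) is a quadratic form over F_p.
   If a is not in F_p, or a = 0 and b <> 0, these conditions are independent
   and the weight is generic.  If a is in F_p^*, they become Tr x = - Q(y) and
   Q(y) = Tr(y b/a); as Q is nondegenerate when m/v = 2 mod 4, completing the
   square turns the latter into Q(y - c) = Q(c) with c determined by b/a, so the
   weight only depends on whether Q(c) = 0.
   The fiber sizes n_t = #{Q = t} are equal for all t in F_p^*, and counting
   the pairs with Q(y) = Q(y') gives (n_0 - n_1)^2 = q, that is
   n_0 - n_1 = +p^s or -p^s.  The sign is negative because the roots of unity of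
   order p^v + 1 act freely on {Q = 1}. *)

(** * Frobenius powers and the prime subfield *)

Section PrimeSubfield.
Set Implicit Arguments.
Unset Strict Implicit.
Variables (F : finFieldType) (p : nat).
Hypothesis charFp : p \in [pchar F].

Let p_pr : prime p := pcharf_prime charFp.

Lemma frobD (i : nat) (x y : F) :
  (x + y) ^+ (p ^ i) = x ^+ (p ^ i) + y ^+ (p ^ i).
Proof.
apply: exprDn_pchar; apply/pnatP => [|r r_pr]; first by rewrite expn_gt0 prime_gt0.
by rewrite Euclid_dvdX // => /andP[]; rewrite dvdn_prime2 // => /eqP->.
Qed.

Lemma frob0 (i : nat) : (0 : F) ^+ (p ^ i) = 0.
Proof. by rewrite expr0n expn_eq0 -leqn0 leqNgt prime_gt0. Qed.

Lemma frobN (i : nat) (x : F) : (- x) ^+ (p ^ i) = - x ^+ (p ^ i).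
Proof. by apply/eqP; rewrite -addr_eq0 -frobD addNr frob0. Qed.

Lemma frob_iter (a j : nat) (x : F) :
  x ^+ (p ^ a) = x -> x ^+ (p ^ (a * j)) = x.
Proof.
move=> xa; elim: j => [|j IHj]; first by rewrite muln0 expr1.
by rewrite mulnS expnD exprM xa.
Qed.

(** Traces are valued in [F] itself, so the prime field is taken inside [F] as the fixed points of
    Frobenius. *)
Definition primeSub : {set F} := [set t | t ^+ p == t].

Lemma primeSubE (t : F) : (t \in primeSub) = (t ^+ p == t).
Proof. by rewrite inE. Qed.

Lemma primeSub0 : 0 \in primeSub.
Proof. by rewrite inE expr0n -leqn0 leqNgt prime_gt0. Qed.

Lemma primeSubD (x y : F) : x \in primeSub -> y \in primeSub -> x + y \in primeSub.
Proof.
by rewrite !inE => /eqP xP /eqP yP; have := frobD 1 x y; rewrite !expn1 xP yP => ->.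
Qed.

Lemma primeSubN (x : F) : x \in primeSub -> - x \in primeSub.
Proof. by rewrite !inE => /eqP xP; have := frobN 1 x; rewrite !expn1 xP => ->. Qed.

Lemma primeSubM (x y : F) : x \in primeSub -> y \in primeSub -> x * y \in primeSub.
Proof. by rewrite !inE exprMn => /eqP-> /eqP->. Qed.

Lemma primeSubV (x : F) : x \in primeSub -> x^-1 \in primeSub.
Proof. by rewrite !inE exprVn => /eqP->. Qed.

Lemma primeSub_frob (i : nat) (x : F) : x \in primeSub -> x ^+ (p ^ i) = x.
Proof.
rewrite inE => /eqP xp; have := @frob_iter 1 i x; rewrite mul1n expn1; exact.
Qed.

Lemma primeSub_nat (k : nat) : k%:R \in primeSub.
Proof.
elim: k => [|k IHk]; first exact: primeSub0.
by rewrite -addn1 natrD primeSubD // inE expr1n.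
Qed.

Lemma card_primeSub_le : (#|primeSub| <= p)%N.
Proof.
have p_gt1 := prime_gt1 p_pr.
have szq : size ('X^p - 'X : {poly F}) = p.+1.
  by rewrite size_polyDl size_polyXn // size_polyN size_polyX ltnS.
have nz : ('X^p - 'X : {poly F}) != 0 by rewrite -size_poly_eq0 szq.
rewrite cardE -ltnS -szq; apply: max_poly_roots => //; last exact: enum_uniq.
apply/allP => x; rewrite mem_enum inE => /eqP xp.
by rewrite /root !hornerE xp subrr.
Qed.

Lemma natr_ord_inj : injective (fun i : 'I_p => (i : nat)%:R : F).
Proof.
move=> i j; wlog le_ij: i j / (i <= j)%N => [hw|eq_ij].
  by case/orP: (leq_total i j) => h e; [exact: hw | apply/esym/hw].
have /eqP : (j - i)%:R = 0 :> F by rewrite natrB // eq_ij subrr.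
rewrite -(dvdn_pcharf charFp) => /dvdnP[[|k] ji]; apply/val_inj => /=.
  by apply/eqP; rewrite eqn_leq le_ij -subn_eq0 ji.
have := ltn_ord j; move: ji; nia.
Qed.

Lemma primeSub_image : primeSub = [set (i : nat)%:R | i : 'I_p].
Proof.
apply/esym/eqP; have sub : [set (i : nat)%:R | i : 'I_p] \subset primeSub.
  by apply/subsetP => _ /imsetP[i _ ->]; exact: primeSub_nat.
rewrite eqEcard sub card_imset ?card_ord; first exact: card_primeSub_le.
exact: natr_ord_inj.
Qed.

Lemma card_primeSub : #|primeSub| = p.
Proof. rewrite primeSub_image card_imset ?card_ord //; exact: natr_ord_inj. Qed.

(** The map [h] sends the fiber over r injectively into the fiber over r + c. As the multiples of c
    exhaust the prime field, going around shows that all p fibers have the same size. This is the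
    main tool for counting solutions of trace equations. *)
Lemma card_fiber_shift (V : finType) (A : {set V}) (g : V -> F) (h : V -> V) (c t : F) :
    c \in primeSub -> c != 0 -> injective h -> (forall x, x \in A -> h x \in A) ->
    (forall x, x \in A -> g x \in primeSub) ->
    (forall x, x \in A -> g (h x) = g x + c) -> t \in primeSub ->
  (#|[set x in A | g x == t]| * p)%N = #|A|.
Proof.
move=> cP c0 h_inj hA gP gh tP; set N := fun t => #|[set x in A | g x == t]|.
have N1 r : (N r <= N (r + c)%R)%N.
  rewrite {1}/N -(card_imset _ h_inj); apply/subset_leq_card/subsetP => y /imsetP[x].
  by rewrite inE => /andP[xA /eqP gx] ->; rewrite inE hA // gh // gx eqxx.
have Nk r k : (N r <= N (r + c *+ k)%R)%N.
  elim: k => [|k IHk]; first by rewrite addr0.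
  by rewrite mulrSr addrA (leq_trans IHk).
(* The number of shifts from r to r' is a natural number representing (r' - r) / c. *)
have Nle r r' : r \in primeSub -> r' \in primeSub -> (N r <= N r')%N.
  move=> rP r'P; have : (r' - r) / c \in primeSub.
    by rewrite primeSubM ?primeSubV // primeSubD // primeSubN.
  rewrite primeSub_image => /imsetP[k _ e].
  suff -> : r' = r + c *+ k by [].
  by rewrite -mulr_natr -e mulrC divfK // subrKC.
rewrite -[RHS]sum1_card (partition_big g (mem primeSub)) //=.
rewrite (eq_bigr (fun=> N t)) => [|r rP].
  by rewrite sum_nat_const card_primeSub mulnC.
rewrite sum1dep_card; apply/eqP.
by rewrite eqn_leq !(Nle, andbT) // /N.
Qed.
End PrimeSubfield.

(** * The absolute trace *)

Section Trace.
Set Implicit Arguments.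
Unset Strict Implicit.
Variables (F : finFieldType) (p m : nat).
Hypotheses (p_pr : prime p) (m_gt0 : (0 < m)%N) (cardF : #|F| = (p ^ m)%N).

Let charFp : p \in [pchar F] := card_finPcharP cardF p_pr.
Local Notation tr := (@Tr F p m).
Local Notation P := (primeSub F p).

Lemma frobK (x : F) : x ^+ (p ^ m) = x.
Proof. by rewrite -cardF expf_card. Qed.

Lemma TrD (x y : F) : tr (x + y) = tr x + tr y.
Proof. by rewrite /Tr -big_split; apply: eq_bigr => i _; rewrite frobD. Qed.

Lemma Tr0 : tr 0 = 0.
Proof. by apply: big1 => i _; rewrite frob0. Qed.

Lemma TrN (x : F) : tr (- x) = - tr x.
Proof. by apply/eqP; rewrite -addr_eq0 -TrD addNr Tr0. Qed.

Lemma TrZ (a x : F) : a \in P -> tr (a * x) = a * tr x.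
Proof.
move=> aP; rewrite /Tr mulr_sumr; apply: eq_bigr => i _.
by rewrite exprMn (primeSub_frob _ aP).
Qed.

(** Frobenius permutes the conjugates of x cyclically, the last one wrapping around by x^(p^m) =
    x. *)
Lemma Tr_frob1 (x : F) : tr (x ^+ p) = tr x.
Proof.
case: m m_gt0 (frobK) => // n _ fK; rewrite /Tr big_ord_recr big_ord_recl /=.
rewrite expr1 -exprM -expnS fK addrC; congr (_ + _).
by apply: eq_bigr => i _; rewrite -exprM -expnS.
Qed.

Lemma Tr_frob (i : nat) (x : F) : tr (x ^+ (p ^ i)) = tr x.
Proof.
by elim: i => [|i IHi]; rewrite ?expr1 // expnSr exprM Tr_frob1.
Qed.

Lemma Tr_prime (x : F) : tr x \in P.
Proof.
rewrite inE -[eqbRHS]Tr_frob1; apply/eqP.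
have powS (s : seq 'I_m) : (\sum_(i <- s) x ^+ (p ^ i)) ^+ p
    = \sum_(i <- s) (x ^+ p) ^+ (p ^ i).
  elim: s => [|i s IHs]; first by rewrite !big_nil (@frob0 _ _ charFp 1).
  rewrite !big_cons -IHs -[p in LHS]expn1 frobD // !expn1.
  by rewrite -!exprM mulnC.
exact: powS.
Qed.

(** Otherwise all p^m elements of F would be roots of the trace polynomial, whose degree is
    p^(m-1). *)
Lemma Tr_neq0 : exists x : F, tr x != 0.
Proof.
apply/existsP; apply: contraT; rewrite negb_exists => /forallP tr0.
pose q : {poly F} := \sum_(i < m) 'X^(p ^ i).
have p_gt1 := prime_gt1 p_pr.
have szq n : (0 < n)%N ->
    size (\sum_(i < n) 'X^(p ^ i) : {poly F}) = (p ^ n.-1).+1.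
  case: n => // n _; elim: n => [|n IHn]; first by rewrite big_ord1 size_polyXn.
  rewrite big_ord_recr /= addrC size_polyDl size_polyXn // IHn ltnS.
  by rewrite ltn_exp2l.
have q0 : q != 0 by rewrite -size_poly_eq0 szq.
have := @max_poly_roots _ q (enum F) q0 _ (enum_uniq _).
rewrite -cardE szq // cardF => /(_ _)/wrap[].
  apply/allP => x _; rewrite /root horner_sum.
  by rewrite (eq_bigr _ (fun i _ => hornerXn _ _)) -[_ == _]negbK tr0.
by rewrite ltnS leq_exp2l // -ltnS prednK // ltnn.
Qed.

Lemma card_Tr_mul (b t : F) : b != 0 -> t \in P ->
  (#|[set y | tr (b * y)%R == t]| * p = p ^ m)%N.
Proof.
move=> b0 tP; have [x x0] := Tr_neq0.
have := @card_fiber_shift _ _ charFp F setT (fun y => tr (b * y)) (+%R^~ (x / b)) (tr x) t.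
rewrite cardsT cardF => <- //; try exact: Tr_prime.
- by congr (_ * _)%N; apply: eq_card => y; rewrite !inE.
- exact: addIr.
- by move=> y _; exact: Tr_prime.
- by move=> y _; rewrite mulrDr TrD (mulrC b (x / b)) divfK.
Qed.

End Trace.

(** * Roots of unity in finite fields *)

Lemma finField_prim_root (F : finFieldType) (n : nat) :
  (n %| #|F|.-1)%N -> exists z : F, n.-primitive_root z.
Proof.
have gt1 := finNzRing_gt1 F; move=> n_dvd.
have : has #|F|.-1.-primitive_root (enum [pred x : F | x != 0]).
  apply: cyclic.has_prim_root; rewrite ?enum_uniq //.
  - by rewrite -subn1 subn_gt0.
  - apply/allP => x; rewrite mem_enum inE /= => x0; apply/unity_rootP/(mulfI x0).
    by rewrite mulr1 -exprS prednK ?expf_card // ltnW.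
  - by rewrite -cardE cardC1.
move=> /hasP[z _ z_prim]; exists (z ^+ (#|F|.-1 %/ n)).
exact: dvdn_prim_root n_dvd.
Qed.

(* Multiplication by z acts freely on A, with the fibers of y |-> y^n as orbits. *)
Lemma dvdn_card_prim_root (F : finFieldType) (n : nat) (z : F) (A : {set F}) :
    n.-primitive_root z -> 0 \notin A -> (forall y, y \in A -> z * y \in A) ->
  (n %| #|A|)%N.
Proof.
move=> z_prim A0 zA; have n_gt0 := prim_order_gt0 z_prim.
have zkA k y : y \in A -> z ^+ k * y \in A.
  by move=> yA; elim: k => [|k IHk]; rewrite ?mul1r // exprS -mulrA zA.
rewrite -sum1_card (partition_big (fun y => y ^+ n) (mem [set y ^+ n | y in A])) /=.
  apply: dvdn_sum => _ /imsetP[y yA ->]; rewrite sum1dep_card.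
  have y0 : y != 0 by apply: contraNneq A0 => <-.
  rewrite (_ : [set _ | _] = [set z ^+ (i : nat) * y | i : 'I_n]).
    rewrite card_imset ?card_ord // => i j /(mulIf y0)/eqP.
    by rewrite (eq_prim_root_expr z_prim) !modn_small ?ltn_ord // => /eqP/val_inj.
  apply/setP => x; rewrite inE; apply/andP/imsetP => [[xA /eqP xy]|[i _ ->]].
    have xy1 : (x / y) ^+ n = 1.
      by rewrite expr_div_n xy divff // expf_neq0.
    have [i xi] := prim_rootP z_prim xy1.
    by exists i => //; rewrite -xi divfK.
  split; first exact: zkA.
  by rewrite exprMn exprAC (prim_expr_order z_prim) expr1n mul1r.
by move=> y yA; apply/imsetP; exists y.
Qed.

(** * The quadratic form Q(y) = Tr(y^(p^u+1)) and its polar form *)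

Section GoldForm.
Set Implicit Arguments.
Unset Strict Implicit.
Variables (F : finFieldType) (p v j l s m u : nat).
Hypotheses (p_pr : prime p) (p_odd : odd p) (v_gt0 : (0 < v)%N).
(* Together these say that v = gcd(m,u) up to a common odd factor of 2j+1 and
   2l+1, with m/v = 2 mod 4. *)
Hypotheses (sE : s = (v * j.*2.+1)%N) (mE : m = s.*2) (uE : u = (v * l.*2.+1)%N).
Hypothesis cardF : #|F| = (p ^ m)%N.

Let charFp : p \in [pchar F] := card_finPcharP cardF p_pr.
Let s_gt0 : (0 < s)%N. Proof. by rewrite sE muln_gt0 v_gt0. Qed.
Let m_gt0 : (0 < m)%N. Proof. by rewrite mE double_gt0. Qed.
Local Notation tr := (@Tr F p m).
Local Notation P := (primeSub F p).

Definition gold (y : F) : F := tr (y ^+ (p ^ u).+1).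

(* Since z^(p^(m u)) = z, the second term is the image of z under the inverse of
   the automorphism z |-> z^(p^u). *)
Definition gold_lin (z : F) : F := z ^+ (p ^ u) + z ^+ (p ^ (m.-1 * u)).

Lemma gold_prime (y : F) : gold y \in P.
Proof. exact: Tr_prime. Qed.

Lemma gold0 : gold 0 = 0.
Proof. by rewrite /gold expr0n Tr0. Qed.

Lemma goldN (y : F) : gold (- y) = gold y.
Proof. by rewrite /gold exprNn -signr_odd /= oddX p_odd orbT mul1r. Qed.

Lemma goldD (w z : F) : gold (w + z) = gold w + gold z + tr (w * gold_lin z).
Proof.
(* The trace is invariant under z |-> z^(p^u); applying this power to the right-hand side frees w of
   its exponent, at the price of the inverse power on z. *)
have zw : tr (z * w ^+ (p ^ u)) = tr (w * z ^+ (p ^ (m.-1 * u))).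
  rewrite -[RHS](Tr_frob m_gt0 cardF u) exprMn -exprM -expnD addnC -mulSn.
  by rewrite prednK // (frob_iter u (frobK cardF z)) mulrC.
rewrite /gold exprS frobD // /gold_lin !(mulrDl, mulrDr) !TrD // -!exprS zw.
ring.
Qed.

Lemma gold_linD (w z : F) : gold_lin (w + z) = gold_lin w + gold_lin z.
Proof. by rewrite /gold_lin !frobD // addrACA. Qed.

Lemma gold_linN (z : F) : gold_lin (- z) = - gold_lin z.
Proof. by rewrite /gold_lin !frobN // opprD. Qed.

(* Raising to the power p^u turns gold_lin z = 0 into z^(p^(2u)) = - z, and
   2u(2j+1) = m(2l+1) is an odd multiple of 2u, so that z = - z. *)
Lemma gold_lin_eq0 (z : F) : (gold_lin z == 0) = (z == 0).
Proof.
apply/eqP/eqP => [phi0|->]; last by rewrite /gold_lin !frob0 // addr0.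
have z2 : z ^+ (p ^ (u + u)) = - z.
  apply/eqP; rewrite -addr_eq0 -(frob0 charFp u) -phi0 frobD // -!exprM -!expnD.
  rewrite [(m.-1 * u + u)%N]addnC -mulSn prednK //.
  by rewrite (frob_iter u (frobK cardF z)).
have z4 : z ^+ (p ^ (u + u + (u + u))) = z.
  by rewrite expnD exprM z2 frobN // z2 opprK.
have : z ^+ (p ^ (m * l.*2.+1)) = - z.
  rewrite (_ : m * _ = (u + u + (u + u)) * j + (u + u))%N; last by rewrite mE sE uE; lia.
  by rewrite expnD exprM (frob_iter _ z4).
rewrite (frob_iter _ (frobK cardF z)) => /eqP; rewrite -addr_eq0 -mulr2n -mulr_natr.
rewrite mulf_eq0 -(dvdn_pcharf charFp) => /orP[/eqP//|].
by rewrite dvdn_prime2 // => /eqP p2; move: p_odd; rewrite p2.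
Qed.

Lemma gold_lin_inj : injective gold_lin.
Proof.
move=> w z wz; apply/eqP; rewrite -subr_eq0 -gold_lin_eq0 gold_linD gold_linN.
by rewrite wz subrr.
Qed.

(** Nondegeneracy in the form needed later: every linear form y |-> Tr(by) is the polar form against
    some c. *)
Lemma gold_lin_surj (b : F) : exists c, gold_lin c = b.
Proof. by have [g _ gK] := injF_bij gold_lin_inj; exists (g b). Qed.

(** * Fiber sizes of the quadratic form *)

Definition goldfib (t : F) : nat := #|[set y | gold y == t]|.
Arguments goldfib t%_R.

(** Pairs with equal value are sorted by their difference z. For z = 0 all y qualify; for z <> 0 the
    condition becomes Tr(y * [gold_lin z]) = - Q(z), an affine hyperplane by nondegeneracy. *)
Lemma card_gold_pairs :
  (\sum_(y : F) goldfib (gold y) = p ^ m.-1 * (p ^ m).-1 + p ^ m)%N.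
Proof.
transitivity (\sum_(z : F) #|[set y | gold (y + z)%R == gold y]|)%N.
  under eq_bigr => y _ do rewrite /goldfib -sum1dep_card big_mkcond
    (reindex_inj (addrI y)) /=.
  by rewrite exchange_big /=; apply: eq_bigr => z _; rewrite -big_mkcond sum1dep_card.
rewrite (bigD1 (0 : F)) //= addnC; congr (_ + _)%N; last first.
  rewrite -cardF -cardsT; apply: eq_card => y; rewrite !inE addr0 eqxx //.
rewrite (eq_bigr (fun=> p ^ m.-1)%N) => [|z z0].
  rewrite sum_nat_const mulnC; congr (_ * _)%N.
  by rewrite cardC1 cardF.
apply/eqP; rewrite -(eqn_pmul2r (prime_gt0 p_pr)) -expnSr prednK //; apply/eqP.
rewrite -(@card_Tr_mul _ _ _ p_pr m_gt0 cardF (gold_lin z) (- gold z)).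
- congr (_ * _)%N; apply: eq_card => y; rewrite !inE goldD -addrA.
  by rewrite -[eqbRHS]addr0 (inj_eq (addrI _)) addrC addr_eq0 mulrC.
- by rewrite gold_lin_eq0.
- by rewrite primeSubN // gold_prime.
Qed.


(** Modulo p^v + 1 one has p^v = -1, and s is an odd multiple of v, so p^s = -1. The induction
    raises the odd multiple by 2. *)
Let psv : ((p ^ v).+1 %| (p ^ s).+1)%N.
Proof.
rewrite sE; elim: j => [|i IHi]; first by rewrite muln1.
have e : (p ^ v * p ^ v * (p ^ (v * i.*2.+1)).+1
    = (p ^ (v * i.+1.*2.+1)).+1 + (p ^ v).-1 * (p ^ v).+1)%N.
  have pv_gt0 : (0 < p ^ v)%N by rewrite expn_gt0 prime_gt0.
  rewrite doubleS !mulnS addnA !expnD; nia.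
by rewrite -(dvdn_addl _ (dvdn_mull (p ^ v).-1 (dvdnn (p ^ v).+1))) -e dvdn_mull.
Qed.

(* A root of unity x of order (p-1)(p^v+1): it lies in the subfield of order
   p^(2v), so its norm x^(p^v+1) generates the prime field and equals x^(p^u+1). *)
Let gold_multiplier : exists x : F,
  ((p.-1 * (p ^ v).+1).-primitive_root x) /\ x ^+ (p ^ u).+1 = x ^+ (p ^ v).+1.
Proof.
have n2v : (p.-1 * (p ^ v).+1 %| (p ^ v.*2).-1)%N.
  rewrite -addnn expnD (_ : (_ * _).-1 = (p ^ v).-1 * (p ^ v).+1)%N; last first.
    have : (0 < p ^ v)%N by rewrite expn_gt0 prime_gt0.
    by case: (p ^ v)%N => // k _; rewrite mulSn [RHS]mulnS.
  by rewrite dvdn_mul // predn_exp dvdn_mulr.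
have nq : (p.-1 * (p ^ v).+1 %| #|F|.-1)%N.
  apply: dvdn_trans n2v _; rewrite cardF mE sE doubleMl expnM [X in (_ %| X)%N]predn_exp.
  exact: dvdn_mulr.
have [x x_prim] := finField_prim_root nq; exists x; split=> //.
have x2v : x ^+ (p ^ v.*2) = x.
  rewrite -[(p ^ _)%N]prednK ?expn_gt0 ?prime_gt0 // exprS.
  by have /dvdnP[k ->] := n2v; rewrite mulnC exprM (prim_expr_order x_prim) expr1n mulr1.
rewrite !exprS; congr (_ * _).
rewrite uE (_ : v * _ = v.*2 * l + v)%N; last by lia.
by rewrite expnD exprM (frob_iter _ x2v).
Qed.

(** Multiplying y by the root of unity x scales Q by d = x^(p^v+1), which generates F_p^*. Hence the
    fibers over r and d r are in bijection, and t is a power of d. *)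
Lemma goldfib_unit (t : F) : t \in P -> t != 0 -> goldfib t = goldfib 1.
Proof.
move=> tP t0; have [x [x_prim xu]] := gold_multiplier.
have x0 : x != 0 by rewrite (prim_root_eq0 x_prim) -lt0n (prim_order_gt0 x_prim).
pose d := x ^+ (p ^ v).+1.
have d_prim : p.-1.-primitive_root d.
  have := dvdn_prim_root x_prim (dvdn_mulr (p ^ v).+1 (dvdnn p.-1)).
  by rewrite mulKn // -subn1 subn_gt0 prime_gt1.
have dP : d \in P.
  rewrite inE -[p]prednK ?prime_gt0 // exprS.
  by rewrite (prim_expr_order d_prim) mulr1.
have d0 : d != 0 by rewrite expf_neq0.
have fibd r : goldfib (d * r) = goldfib r.
  rewrite /goldfib -(card_imset [set y | gold y == r] (mulfI x0)).
  apply: eq_card => y; rewrite !inE; apply/eqP/imsetP => [gy|[w]].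
    exists (y / x); last by rewrite mulrC divfK.
    rewrite inE; apply/eqP/(mulfI d0); rewrite -gy -TrZ // /d -xu -exprMn.
    by rewrite mulrC divfK.
  by rewrite inE => /eqP <- ->; rewrite /gold exprMn xu TrZ.
have t1 : t ^+ p.-1 = 1.
  apply/(mulfI t0); rewrite mulr1 -exprS prednK ?prime_gt0 //.
  by move: tP; rewrite inE => /eqP.
have [i ->] := prim_rootP d_prim t1.
by elim: (i : nat) => [|k IHk]; rewrite // exprS fibd.
Qed.

(** The root of unity z = x^(p-1) has order p^v + 1 and satisfies z^(p^u+1) = 1, so multiplication
    by z preserves {Q = 1}, which misses 0. *)
Lemma dvdn_goldfib1 : ((p ^ v).+1 %| goldfib 1)%N.
Proof.
have [x [x_prim xu]] := gold_multiplier.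
have := dvdn_prim_root x_prim (dvdn_mull p.-1 (dvdnn (p ^ v).+1)).
rewrite mulnK // => z_prim; apply: (dvdn_card_prim_root z_prim).
  by rewrite inE gold0 eq_sym oner_eq0.
move=> y; rewrite !inE => /eqP <-; rewrite /gold exprMn -exprM mulnC exprM xu -exprM.
by rewrite mulnC (prim_expr_order x_prim) mul1r.
Qed.

Lemma goldfib_total : (goldfib 0 + p.-1 * goldfib 1 = p ^ m)%N.
Proof.
rewrite -cardF -sum1_card (partition_big gold (mem P)) => [|y _]; last exact: gold_prime.
rewrite (bigD1 (0 : F)) /=; last exact: primeSub0 charFp.
congr (_ + _)%N.
  by rewrite sum1dep_card.
rewrite (eq_bigr (fun=> goldfib 1)) => [|t /andP[tP t0]].
  rewrite sum_nat_const; congr (_ * _)%N.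
  transitivity #|P|.-1; first by rewrite card_primeSub.
  rewrite (cardD1 0) primeSub0 // add1n /=.
  by apply: eq_card => r; rewrite [RHS]unfold_in !inE andbC.
by rewrite sum1dep_card -(goldfib_unit tP t0).
Qed.

Lemma goldfib_square :
  (goldfib 0 * goldfib 0 + (p ^ m - goldfib 0) * goldfib 1
     = p ^ m.-1 * (p ^ m).-1 + p ^ m)%N.
Proof.
rewrite -card_gold_pairs (bigID (fun y => gold y == 0)) /=; congr (_ + _)%N.
  rewrite (eq_bigr (fun=> goldfib 0)) => [|y /eqP-> //].
  by rewrite sum_nat_const; congr (_ * _)%N; apply: eq_card => y; rewrite inE.
rewrite (eq_bigr (fun=> goldfib 1)) => [|y y0]; last first.
  by rewrite goldfib_unit // gold_prime.
rewrite sum_nat_const; congr (_ * _)%N.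
transitivity #|~: [set y | gold y == 0]|; first by rewrite cardsCs setCK cardF.
by apply: eq_card => y; rewrite !inE.
Qed.

(* The second moment gives goldfib 0 - goldfib 1 = +-p^s; the plus sign would
   make p^v+1 divide p^s(p^s-1), hence 2p^s, which is impossible. *)
Lemma goldfib_values :
  (goldfib 0 + p ^ s = goldfib 1 /\ p * goldfib 1 = p ^ m + p ^ s)%N.
Proof.
have pm : (p ^ m = p ^ s * p ^ s)%N by rewrite mE -addnn expnD.
have pm1 : (p * p ^ m.-1 = p ^ m)%N by rewrite -expnS prednK.
have := goldfib_total; have := goldfib_square; have := dvdn_goldfib1.
set n0 := goldfib 0; set n1 := goldfib 1;
have ps_gt0 : (0 < p ^ s)%N by rewrite expn_gt0 prime_gt0.
have psM : (0 < p ^ m)%N by rewrite expn_gt0 prime_gt0.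
move=> Mn1 sq tot.
have qn0 : (p ^ m - n0 = p.-1 * n1)%N by rewrite -tot addKn.
rewrite qn0 in sq.
have psq : (p * (n0 * n0 + p.-1 * n1 * n1) = p ^ m * (p ^ m).-1 + p * p ^ m)%N.
  by rewrite sq mulnDr mulnA pm1.
have pMn : (p * n1 = n1 + p.-1 * n1)%N by rewrite -mulSn prednK ?prime_gt0.
have [|n01] : (n0 = n1 + p ^ s \/ n1 = n0 + p ^ s)%N.
  have r0 : p.-1%:Z != 0 by rewrite eqz_nat -lt0n -subn1 subn_gt0 prime_gt1.
  have : (n0%:Z - n1%:Z) ^+ 2 == (p ^ s)%N%:Z ^+ 2.
    apply/eqP/(mulfI r0); rewrite expr2 [in RHS]expr2 -[in RHS]PoszM -pm.
    have pE : p%:Z = p.-1%:Z + 1 by rewrite -PoszD addn1 prednK ?prime_gt0.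
    have qE : (p ^ m)%N%:Z = (p ^ m).-1%:Z + 1 by rewrite -PoszD addn1 prednK.
    have /(congr1 Posz) := psq; rewrite !(PoszD, PoszM) pE.
    have /(congr1 Posz) := tot; rewrite !(PoszD, PoszM) => totz psqz.
    (* A variance identity: p times the sum of the squared fiber sizes, minus the square of their
       total. With q = p^m it evaluates to q(q-1) + pq - q^2 = (p-1)q. *)
    have -> : p.-1%:Z * ((n0%:Z - n1%:Z) * (n0%:Z - n1%:Z)) =
      (p.-1%:Z + 1) * (n0%:Z * n0%:Z + p.-1%:Z * n1%:Z * n1%:Z)
        - (n0%:Z + p.-1%:Z * n1%:Z) * (n0%:Z + p.-1%:Z * n1%:Z) by ring.
    rewrite psqz totz qE; ring.
  rewrite eqf_sqr => /orP[]/eqP e; [left | right]; apply/eqP; rewrite -eqz_nat PoszD.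
    by rewrite -e addrC subrK.
  by rewrite -[X in _ == _ + X]opprK -e opprB addrC subrK.
- move=> n01; have : ((p ^ v).+1 %| p ^ s * 2)%N.
    have e : (p ^ s * (p ^ s).+1 = p * n1 + p ^ s * 2)%N.
      by rewrite mulnS -pm -tot pMn muln2 -addnn; move: (_ * n1)%N => k; lia.
    by rewrite -(dvdn_addr _ (dvdn_mull p Mn1)) -e dvdn_mull.
  (* Being coprime to p, the number p^v + 1 would divide 2, although p^v >= p > 1. *)
  rewrite Gauss_dvdr => [/dvdn_leq-/(_ isT)|].
    rewrite leqNgt ltnS (leq_trans (prime_gt1 p_pr)) //.
    by rewrite -{1}[p]expn1 leq_pexp2l // prime_gt0.
  by rewrite coprimeXr // -(coprime_pexpr _ _ v_gt0) coprimeSn.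
by split=> //; rewrite -tot pMn {1}n01 addnAC.
Qed.

Local Notation n0 := (goldfib 0).
Local Notation n1 := (goldfib 1).

Let p_gt1 : (1 < p)%N := prime_gt1 p_pr.
Let pm1E : (p * p ^ m.-1 = p ^ m)%N. Proof. by rewrite -expnS prednK. Qed.

(** These inequalities will separate the weights. They are compared after multiplication by p, where
    p n1 = p^m + p^s is available. *)
Lemma goldfib_bounds : [/\ n0 < p ^ m.-1, p ^ m.-1 < n1 & n1 < p ^ m]%N.
Proof.
have [n01 pn1] := goldfib_values.
have ps_gt0 : (0 < p ^ s)%N by rewrite expn_gt0 ltnW.
have psm : (p ^ s < p ^ m)%N by rewrite ltn_exp2l // mE -addnn -{1}[s]addn0 ltn_add2l.
have pps : (p ^ s < p * p ^ s)%N by rewrite -{1}[(p ^ s)%N]mul1n ltn_pmul2r.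
have ppm : (2 * p ^ m <= p * p ^ m)%N by rewrite leq_pmul2r // expn_gt0 ltnW.
have p_lt x y : (p * x < p * y)%N -> (x < y)%N by rewrite ltn_pmul2l // ltnW.
split; apply: p_lt; rewrite ?pm1E ?pn1; [|lia|lia].
by move: pn1; rewrite -n01 mulnDr; lia.
Qed.

(** * Zeros of codewords on the defining set *)

(** The origin is restored to make the counts products; weights do not change, because every form
    Tr(ax + by) vanishes there. *)
Definition D0 : {set F * F} := [set z | tr (z.1 + z.2 ^+ (p ^ u).+1) == 0].

Lemma in_D0 (z : F * F) : (z \in D0) = (tr z.1 + gold z.2 == 0).
Proof. by rewrite inE TrD. Qed.

Lemma D1E : D1 F p m u = D0 :\ (0, 0).
Proof. by apply/setP => z; rewrite !inE. Qed.

Lemma zero_in_D0 : (0, 0) \in D0.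
Proof. by rewrite in_D0 Tr0 // gold0 addr0. Qed.

(** Each y in B leaves p^(m-1) solutions x of Tr x = - Q(y): shifting x by an element of nonzero
    trace makes all values of Tr x + Q(y) equally frequent. *)
Lemma card_D0_fibers (B : {set F}) :
  #|[set z in D0 | z.2 \in B]| = (p ^ m.-1 * #|B|)%N.
Proof.
have [x x0] := Tr_neq0 p_pr m_gt0 cardF.
apply/eqP; rewrite -(eqn_pmul2r (ltnW p_gt1)) mulnAC [(p ^ _ * p)%N]mulnC pm1E; apply/eqP.
rewrite -cardF -cardsT -cardsX.
rewrite -(@card_fiber_shift _ _ charFp _ (setX setT B)
  (fun z => tr z.1 + gold z.2) (fun z => (z.1 + x, z.2)) (tr x) 0) //.
- by congr (_ * _)%N; apply: eq_card => z; rewrite inE in_D0 !inE andbC.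
- exact: Tr_prime.
- by move=> [? ?] [? ?] [/addIr-> ->].
- by move=> z; rewrite !inE.
- by move=> z _; apply: primeSubD => //; [exact: Tr_prime | exact: gold_prime].
- by move=> z _; rewrite /= TrD // addrAC.
- exact: primeSub0.
Qed.

Lemma card_D0 : #|D0| = (p ^ m.-1 * p ^ m)%N.
Proof.
by rewrite -cardF -cardsT -card_D0_fibers; apply: eq_card => z; rewrite !inE andbT.
Qed.

Definition cw_zeros (a b : F) : nat := #|[set z in D0 | tr (a * z.1 + b * z.2) == 0]|.

Lemma wt_cw (a b : F) : (wt p m u (cw p m u a b) + cw_zeros a b = #|D0|)%N.
Proof.
rewrite addnC -[RHS](cardsID [set z | tr (a * z.1 + b * z.2) == 0]).
congr (_ + _)%N; first by apply: eq_card => z; rewrite !inE.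
apply: eq_card => z; rewrite [RHS]inE [in RHS]inE /wt inE ffunE D1E !inE.
have [->|z0] /= := eqVneq z (0, 0); first by rewrite !mulr0 addr0 Tr0 // eqxx.
by case: (tr _ == 0); rewrite ?andbF // andbT.
Qed.

(** Start from x with (a - c) x = x1, where c = Tr(a x1) / Tr x1, and subtract the multiple of x1
    that kills its trace. By the choice of c, the value Tr(ax) becomes Tr((a - c) x) = Tr x1, which
    is nonzero. *)
Lemma exists_Tr_sep (a : F) : a \notin P -> exists x, tr x = 0 /\ tr (a * x) != 0.
Proof.
move=> aP; have [x1 x10] := Tr_neq0 p_pr m_gt0 cardF.
pose c := tr (a * x1) / tr x1.
have cP : c \in P by rewrite primeSubM ?primeSubV // Tr_prime.
have ac : a - c != 0 by apply: contraNneq aP => /eqP; rewrite subr_eq0 => /eqP->.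
pose x := x1 / (a - c); pose r := tr x / tr x1.
have rP : r \in P by rewrite primeSubM ?primeSubV // Tr_prime.
exists (x - r * x1); rewrite TrD // TrN // TrZ // divfK // subrr; split=> //.
rewrite mulrBr TrD // TrN // (mulrCA a r) (TrZ _ _ rP).
have -> : r * tr (a * x1) = c * tr x by rewrite /r /c; ring.
by rewrite -(TrZ _ _ cP) // -TrN // -TrD // -mulrBl mulrC divfK.
Qed.

(** If a is not in F_p, translating x by the vector of [exists_Tr_sep] stays in [D0] and moves the
    codeword's value. If a = 0, the condition Tr(by) = 0 only cuts out a hyperplane of y. *)
Lemma cw_zeros_generic (a b : F) :
  (a \notin P) || (a == 0) && (b != 0) -> cw_zeros a b = (p ^ m.-1 * p ^ m.-1)%N.
Proof.
case/orP => [aP|/andP[/eqP-> b0]]; apply/eqP; rewrite -(eqn_pmul2r (ltnW p_gt1)).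
  have [x [x0 ax0]] := exists_Tr_sep aP.
  rewrite -mulnA [in eqbRHS](mulnC _ p) pm1E -card_D0 /cw_zeros.
  rewrite (@card_fiber_shift _ _ charFp _ D0 (fun z => tr (a * z.1 + b * z.2))
    (fun z => (z.1 + x, z.2)) (tr (a * x)) 0) ?primeSub0 //; try by move=> *; exact: Tr_prime.
  - by move=> [? ?] [? ?] [/addIr-> ->].
  - by move=> z; rewrite !in_D0 /= TrD // x0 addr0.
  - by move=> z _; rewrite /= mulrDr addrAC TrD.
rewrite -mulnA [in eqbRHS](mulnC _ p) pm1E.
rewrite -(@card_Tr_mul _ _ _ p_pr m_gt0 cardF b 0 b0 (primeSub0 charFp)) mulnA.
rewrite -card_D0_fibers; apply/eqP; congr (_ * _)%N.
by apply: eq_card => z; rewrite !inE mul0r add0r.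
Qed.

(* Completing the square: gold y = tr (y * gold_lin c) iff gold (y - c) = gold c. *)
Lemma cw_zeros_gold (a c : F) : a \in P -> a != 0 ->
  cw_zeros a (a * gold_lin c) = (p ^ m.-1 * goldfib (gold c))%N.
Proof.
move=> aP a0; rewrite /goldfib -(card_imset [set y | gold y == gold c] (addIr c)).
rewrite -card_D0_fibers; apply: eq_card => z; rewrite !inE.
rewrite TrD // -/(gold z.2); case: eqP => //= /eqP; rewrite addr_eq0 => /eqP z1.
rewrite -mulrA -mulrDr TrZ // mulf_eq0 (negbTE a0) /= TrD // z1 mulrC.
apply/idP/imsetP => [e|[y]].
  exists (z.2 - c); last by rewrite subrK.
  rewrite inE goldD goldN gold_linN mulrN TrN // addrAC -[eqbRHS]add0r.
  by rewrite (inj_eq (addIr _)) subr_eq0 -subr_eq0 -oppr_eq0 opprB addrC.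
rewrite inE => /eqP gy zE; have := goldD z.2 (- c).
rewrite goldN gold_linN mulrN TrN // {1}zE addrK gy => /eqP.
rewrite addrAC -[eqbLHS]add0r (inj_eq (addIr _)) eq_sym => /eqP e.
by rewrite addrC -opprB e oppr0.
Qed.

Lemma wt_generic (a b : F) : (a \notin P) || (a == 0) && (b != 0) ->
  wt p m u (cw p m u a b) = (p ^ m.-1 * (p ^ m - p ^ m.-1))%N.
Proof.
move=> ab; have := wt_cw a b; rewrite cw_zeros_generic // card_D0 => e.
by rewrite mulnBr -e addnK.
Qed.

Lemma wt_gold (a c : F) : a \in P -> a != 0 ->
  wt p m u (cw p m u a (a * gold_lin c)) = (p ^ m.-1 * (p ^ m - goldfib (gold c)))%N.
Proof.
move=> aP a0; have := wt_cw a (a * gold_lin c); rewrite cw_zeros_gold // card_D0 => e.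
by rewrite mulnBr -e addnK.
Qed.


(** * Classification of codewords by weight *)

Local Notation cwz := (@cw F p m u).
Local Notation wtz := (@wt F p m u).
(* The weight of a codeword with p^(m-1) t zeros on D0. *)
Local Notation W t := (p ^ m.-1 * (p ^ m - t))%N.

Lemma cwD (a b a' b' : F) : cwz a b + cwz a' b' = cwz (a + a') (b + b').
Proof.
apply/ffunP => z; rewrite !ffunE; case: ifP => _; last by rewrite addr0.
by rewrite -TrD // !mulrDl addrACA.
Qed.

Lemma cw0 : cwz 0 0 = 0.
Proof. by apply/ffunP => z; rewrite !ffunE !mul0r addr0 Tr0 // if_same. Qed.

Lemma cwMn (a b : F) (k : nat) : cwz a b *+ k = cwz (a *+ k) (b *+ k).
Proof. by elim: k => [|k IHk]; rewrite ?mulr0n ?cw0 // !mulrS IHk cwD. Qed.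

Lemma wt0 : wtz 0 = 0%N.
Proof. by apply: eq_card0 => z; rewrite inE ffunE eqxx andbF. Qed.

Lemma W_lt (t t' : nat) : (t' < t)%N -> (t' < p ^ m)%N -> (W t < W t')%N.
Proof.
by move=> tt' t'm; rewrite ltn_pmul2l ?expn_gt0 ?(ltnW p_gt1) // ltn_sub2l.
Qed.

(** Strictness lets a weight determine which case of [cw_spec] it comes from. *)
Lemma W_order : [/\ 0 < W n1, W n1 < W (p ^ m.-1) & W (p ^ m.-1) < W n0]%N.
Proof.
have [n0lt n1gt n1lt] := goldfib_bounds.
have Qlt := ltn_trans n1gt n1lt; split.
- by rewrite muln_gt0 expn_gt0 ltnW // subn_gt0.
- exact: W_lt.
- exact: W_lt n0lt (ltn_trans n0lt Qlt).
Qed.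

Lemma wt_gold0 (a c : F) : a \in P -> a != 0 -> gold c = 0 ->
  wtz (cwz a (a * gold_lin c)) = W n0.
Proof. by move=> aP a0 c0; rewrite wt_gold // c0. Qed.

Lemma wt_gold1 (a c : F) : a \in P -> a != 0 -> gold c != 0 ->
  wtz (cwz a (a * gold_lin c)) = W n1.
Proof. by move=> aP a0 c0; rewrite wt_gold // goldfib_unit // gold_prime. Qed.

(** In the last two cases c is the center obtained by completing the square, and only the vanishing
    of Q(c) affects the weight. *)
Variant cw_spec (a b : F) : nat -> Prop :=
| CwZero of a = 0 & b = 0 : cw_spec a b 0
| CwGeneric of (a \notin P) || (a == 0) && (b != 0) : cw_spec a b (W (p ^ m.-1))
| CwIsotropic c of a \in P & a != 0 & b = a * gold_lin c & gold c = 0 :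
    cw_spec a b (W n0)
| CwAnisotropic c of a \in P & a != 0 & b = a * gold_lin c & gold c != 0 :
    cw_spec a b (W n1).

Lemma cwP (a b : F) : cw_spec a b (wtz (cwz a b)).
Proof.
have [a0|a0] := eqVneq a 0.
  have [b0|b0] := eqVneq b 0; first by rewrite a0 b0 cw0 wt0; exact: CwZero.
  have g : (a \notin P) || (a == 0) && (b != 0) by rewrite a0 eqxx b0 orbT.
  by rewrite wt_generic //; exact: CwGeneric.
have [aP|aP] := boolP (a \in P); last first.
  have g : (a \notin P) || (a == 0) && (b != 0) by rewrite aP.
  by rewrite wt_generic //; exact: CwGeneric.
have [c bc] := gold_lin_surj (b / a).
have bE : b = a * gold_lin c by rewrite bc mulrC divfK.
have [c0|c0] := eqVneq (gold c) 0.
  by rewrite {2}bE wt_gold0 //; apply: CwIsotropic bE c0.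
by rewrite {2}bE wt_gold1 //; apply: CwAnisotropic bE c0.
Qed.

Lemma wt_cw_eq0 (a b : F) : wtz (cwz a b) = 0%N -> (a, b) = (0, 0).
Proof.
have [W1 W2 W3] := W_order; case: cwP => [-> -> //||c|c] *; exfalso; lia.
Qed.

(** By linearity it suffices that only the zero pair gives weight 0. This yields dimension 2m and
    lets multiplicities be counted on pairs (a,b). *)
Lemma cw_inj : injective (fun ab : F * F => cwz ab.1 ab.2).
Proof.
move=> [a b] [a' b'] /= e.
have : wtz (cwz (a - a') (b - b')) = 0%N.
  have -> : cwz (a - a') (b - b') = 0; last exact: wt0.
  by apply: (addIr (cwz a' b')); rewrite cwD !subrK e add0r.
by move=> /wt_cw_eq0[/subr0_eq-> /subr0_eq->].
Qed.

Lemma card_code : #|code (F := F) p m u| = (p ^ (2 * m))%N.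
Proof. by rewrite card_imset ?card_prod ?cardF -?expnD ?addnn ?mul2n //; exact: cw_inj. Qed.

(** * Multiplicities of the weights *)

Lemma multE (w : nat) : mult (F := F) p m u w = #|[set ab : F * F | wtz (cwz ab.1 ab.2) == w]|.
Proof.
rewrite /mult -(card_imset [set ab : F * F | wtz (cwz ab.1 ab.2) == w] cw_inj).
apply: eq_card => c; rewrite inE; apply/andP/imsetP => [[/imsetP[ab _ ->] w_ab]|[ab]].
  by exists ab; rewrite ?inE.
by rewrite inE => w_ab ->; split=> //; apply: imset_f.
Qed.

Lemma mult0 : mult (F := F) p m u 0 = 1%N.
Proof.
rewrite multE -(cards1 (0 : F, 0 : F)); apply: eq_card => -[a b]; rewrite !inE /=.
apply/eqP/eqP => [/wt_cw_eq0 //|[-> ->]]; by rewrite cw0 wt0.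
Qed.

Lemma cards_primeSubD0 : #|P :\ 0| = p.-1.
Proof. by rewrite -[in RHS](card_primeSub charFp) [in RHS](cardsD1 0) primeSub0. Qed.

Lemma gold_param_inj (B : {set F}) :
  {in setX (P :\ 0) B &, injective (fun ac : F * F => (ac.1, ac.1 * gold_lin ac.2))}.
Proof.
move=> [a c] [a' c']; rewrite !inE => /andP[/andP[a0 _] _] _ /= [<-].
by move=> /(mulfI a0)/gold_lin_inj->.
Qed.

(** The pairs of weight w are parametrized bijectively by (a,c) in F_p^* x B, through b = a *
    [gold_lin c]. *)
Lemma mult_gold (B : {set F}) (w : nat) :
    (forall a b, wtz (cwz a b) = w <->
       exists c, [/\ a \in P, a != 0, b = a * gold_lin c & c \in B]) ->
  mult (F := F) p m u w = (p.-1 * #|B|)%N.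
Proof.
move=> wB; rewrite multE -cards_primeSubD0 -cardsX -(card_in_imset (@gold_param_inj B)).
apply: eq_card => -[a b]; rewrite inE /=; apply/eqP/imsetP => [/wB[c [aP a0 -> cB]]|].
  by exists (a, c); rewrite //= !inE a0 -primeSubE aP cB.
move=> [[a' c]]; rewrite in_setX in_setD1 => /andP[/andP[/= a0 aP] cB] [-> ->].
by apply/wB; exists c.
Qed.

Lemma mult_isotropic : mult (F := F) p m u (W n0) = (p.-1 * n0)%N.
Proof.
have [W1 W2 W3] := W_order.
apply: mult_gold => a b; split=> [|[c [aP a0 ->]]]; last first.
  by rewrite inE => /eqP; exact: wt_gold0.
case: cwP => [||c aP a0 bE c0 _|]; try by (move=> *; exfalso; lia).
by exists c; split; rewrite // inE c0.
Qed.

Lemma mult_anisotropic : mult (F := F) p m u (W n1) = (p.-1 * (p ^ m - n0))%N.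
Proof.
have [W1 W2 W3] := W_order.
have -> : (p ^ m - n0 = #|~: [set c | gold c == 0%R]|)%N by rewrite cardsCs setCK cardF.
apply: mult_gold => a b; split=> [|[c [aP a0 ->]]]; last by rewrite !inE; exact: wt_gold1.
case: cwP => [|||c aP a0 bE c0 _]; try by (move=> *; exfalso; lia).
by exists c; split; rewrite // !inE.
Qed.

(** Counted by complement: the excluded pairs are (0,0) and the (p-1) p^m pairs with a in F_p^*. *)
Lemma mult_generic :
  mult (F := F) p m u (W (p ^ m.-1)) = (p ^ m * p ^ m - (1 + p.-1 * p ^ m))%N.
Proof.
have [W1 W2 W3] := W_order.
rewrite multE cardsCs card_prod cardF; congr (_ - _)%N.
rewrite -[in RHS]cardF -cardsT -cards_primeSubD0 -cardsX -(cards1 (0 : F, 0 : F)).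
have disj : [set (0 : F, 0 : F)] :&: setX (P :\ 0) setT = set0.
  by apply/setP => -[a b]; rewrite !inE xpair_eqE; case: eqP => //= _; rewrite andbF.
rewrite -[RHS]subn0 -(cards0 (F * F)%type) -disj -cardsU; apply: eq_card => -[a b].
rewrite !(in_setU, in_setC, in_setX, in_setD1, in_set1, in_setT) andbT inE /=.
case: cwP => [-> ->|/orP[aP|/andP[/eqP-> b0]]|c aP a0 _ _|c aP a0 _ _].
- by rewrite eqxx /=; apply/eqP; lia.
- by rewrite eqxx (negbTE aP) xpair_eqE; case: eqP aP => // ->; rewrite primeSub0.
- by rewrite !eqxx xpair_eqE eqxx (negbTE b0).
- by rewrite a0 aP orbT; apply/eqP; lia.
- by rewrite a0 aP orbT; apply/eqP; lia.
Qed.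


Lemma wt_values (c : {ffun F * F -> F}) : c \in code (F := F) p m u ->
  wtz c \in [:: 0; W (p ^ m.-1); W n0; W n1]%N.
Proof.
by move=> /imsetP[[a b] _ ->] /=; case: cwP => *; rewrite !inE eqxx ?orbT.
Qed.

Lemma card_D1 : #|D1 F p m u| = (p ^ (2 * m - 1) - 1)%N.
Proof.
have := cardsD1 (0, 0) D0; rewrite zero_in_D0 -D1E card_D0 -expnD => e.
have -> : (2 * m - 1 = m.-1 + m)%N by lia.
by rewrite e addKn.
Qed.

(** * Closed forms over the rationals *)

Local Notation A := ((p ^ s.-1)%:R : rat).
Local Notation pQ := (p%:R : rat).

(** With A = p^(s-1), the powers p^s, p^m and p^(m-1) are monomials in p and A, so the remaining
    identities are left to [ring] and [field]. *)
Let psE : (p ^ s)%:R = pQ * A.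
Proof. by rewrite -natrM -expnS prednK. Qed.

Let pmE : (p ^ m)%:R = (pQ * A) ^+ 2.
Proof. by rewrite mE -muln2 expnM natrX psE. Qed.

Let pm1Q : (p ^ m.-1)%:R = pQ * A ^+ 2.
Proof.
rewrite mE -{1}[s]prednK // doubleS /= -addnn -addSn.
by rewrite expnD natrM expnS natrM mulrA.
Qed.

Let p_neq0 : pQ != 0. Proof. by rewrite pnatr_eq0 -lt0n ltnW. Qed.

Let A_neq0 : A != 0. Proof. by rewrite pnatr_eq0 -lt0n expn_gt0 ltnW. Qed.

Lemma goldfib1_rat : n1%:R = pQ * A ^+ 2 + A.
Proof.
have [_ /(congr1 (fun n => n%:R : rat))] := goldfib_values.
rewrite natrM natrD pmE psE => e; apply: (mulfI p_neq0); rewrite e; ring.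
Qed.

Lemma goldfib0_rat : n0%:R = pQ * A ^+ 2 + A - pQ * A.
Proof.
have [/(congr1 (fun n => n%:R : rat)) + _] := goldfib_values.
by rewrite natrD psE goldfib1_rat => <-; rewrite addrK.
Qed.

Lemma W_rat (t : nat) : (t <= p ^ m)%N ->
  (W t)%:R = pQ * A ^+ 2 * ((pQ * A) ^+ 2 - t%:R).
Proof. by move=> tm; rewrite natrM pm1Q natrB // pmE. Qed.

Lemma W_generic_rat : (W (p ^ m.-1))%:R = (pQ - 1) * (pQ * A ^+ 2) ^+ 2.
Proof.
have Qle : (p ^ m.-1 <= p ^ m)%N by rewrite leq_pexp2l ?leq_pred // ltnW.
rewrite W_rat // pm1Q.
ring.
Qed.

Lemma W_isotropic_rat :
  (W n0)%:R = (pQ - 1) * (pQ * A ^+ 2) ^+ 2 * (1 + 1 / (pQ * A)).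
Proof.
have [n0lt n1gt n1lt] := goldfib_bounds.
rewrite W_rat ?goldfib0_rat; last by lia.
by field; rewrite p_neq0 A_neq0.
Qed.

Lemma W_anisotropic_rat :
  (W n1)%:R = (pQ - 1) * (pQ * A ^+ 2) ^+ 2 * (1 - 1 / ((pQ - 1) * (pQ * A))).
Proof.
have [_ _ n1lt] := goldfib_bounds.
have p1_neq0 : pQ - 1 != 0 by rewrite subr_eq0 pnatr_eq1 gtn_eqF.
rewrite W_rat ?goldfib1_rat; last by lia.
by field; rewrite p_neq0 A_neq0 p1_neq0.
Qed.

Let p1Q : p.-1%:R = pQ - 1. Proof. by rewrite -subn1 natrB // ltnW. Qed.

Lemma mult_generic_rat :
  (mult (F := F) p m u (W (p ^ m.-1)))%:R
    = (pQ * A) ^+ 4 - 1 - (pQ - 1) * (pQ * A) ^+ 2.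
Proof.
have pm_ge : (p <= p ^ m)%N by rewrite -{1}[p]expn1 leq_pexp2l // ltnW.
have le : (1 + p.-1 * p ^ m <= p ^ m * p ^ m)%N.
  apply: leq_trans (leq_mul pm_ge (leqnn _)); rewrite -{3}[p]prednK ?(ltnW p_gt1) //.
  by rewrite mulSn leq_add2r expn_gt0 ltnW.
rewrite mult_generic natrB // natrD !natrM p1Q pmE; ring.
Qed.

Lemma mult_isotropic_rat :
  (mult (F := F) p m u (W n0))%:R = (pQ - 1) * (pQ * A ^+ 2 - pQ * A + A).
Proof. by rewrite mult_isotropic natrM p1Q goldfib0_rat; ring. Qed.

Lemma mult_anisotropic_rat :
  (mult (F := F) p m u (W n1))%:R = (pQ - 1) * (pQ * A + 1) * (pQ * A - A).
Proof.
have [n0lt n1gt n1lt] := goldfib_bounds.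
rewrite mult_anisotropic natrM p1Q natrB ?pmE ?goldfib0_rat; last by lia.
ring.
Qed.

End GoldForm.

(** * Parameters and conclusion *)

(** The hypothesis makes m/v twice an odd number; u/v is coprime to it, hence odd. *)
Lemma gcd_ratio (m u : nat) : (0 < u)%N -> ((m %/ gcdn m u) %% 4 = 2)%N ->
  exists j l, m = (gcdn m u * j.*2.+1).*2 /\ u = (gcdn m u * l.*2.+1)%N.
Proof.
move=> u_gt0; set v := gcdn m u => mv.
have v_gt0 : (0 < v)%N by rewrite gcdn_gt0 u_gt0 orbT.
have mE : m = (m %/ v * v)%N by rewrite divnK ?dvdn_gcdl.
have uE : u = (u %/ v * v)%N by rewrite divnK ?dvdn_gcdr.
have cop : coprime (m %/ v) (u %/ v).
  by rewrite /coprime -(eqn_pmul2r v_gt0) muln_gcdl -mE -uE mul1n.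
have mv4 := divn_eq (m %/ v) 4; rewrite mv in mv4.
have odd_uv : odd (u %/ v).
  rewrite -[odd _]negbK -dvdn2; apply/negP => uv2.
  have mv2 : (2 %| m %/ v)%N by rewrite mv4 dvdn_add // dvdn_mull.
  by have := dvdn_gcd 2 (m %/ v) (u %/ v); rewrite mv2 uv2 (eqP cop).
exists (m %/ v %/ 4)%N, (u %/ v)./2; split.
  by rewrite {1}mE {1}mv4; move: (m %/ v %/ 4)%N => k; rewrite mulnC; lia.
by rewrite {1}uE mulnC -{1}[(u %/ v)%N]odd_double_half odd_uv.
Qed.

Theorem theorem3 (p m u : nat) (F : finFieldType) :
  prime p -> odd p -> (0 < m)%N -> ~~ odd m -> #|F| = (p ^ m)%N -> (0 < u)%N ->
  let s := m./2 in
  let v := gcdn m u in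
  ((m %/ v) %% 4 = 2)%N ->
  let w1 : rat := (p%:Q - 1) * p%:Q ^+ (2 * m - 2) in
  let w2 : rat := (p%:Q - 1) * p%:Q ^+ (2 * m - 2) * (1 + 1 / p%:Q ^+ s) in
  let w3 : rat := (p%:Q - 1) * p%:Q ^+ (2 * m - 2)
                    * (1 - 1 / ((p%:Q - 1) * p%:Q ^+ s)) in
  (* linear over F_p *)
  (forall c1 c2, c1 \in code (F:=F) p m u -> c2 \in code (F:=F) p m u -> c1 + c2 \in code (F:=F) p m u) /\
  (forall (k : nat) c, c \in code (F:=F) p m u -> c *+ k \in code (F:=F) p m u) /\
  (* length p^(2m-1) - 1 and dimension 2m *)
  #|D1 F p m u| = (p ^ (2 * m - 1) - 1)%N /\
  #|code (F:=F) p m u| = (p ^ (2 * m))%N /\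
  (* only weights 0, w1, w2, w3 occur *)
  (forall c, c \in code (F:=F) p m u ->
     let w := (wt (F:=F) p m u c)%:Q in [|| w == 0, w == w1, w == w2 | w == w3]) /\
  (* weight distribution *)
  mult (F:=F) p m u 0 = 1%N /\
  (exists n1 : nat, n1%:Q = w1 /\
     (mult (F:=F) p m u n1)%:Q = p%:Q ^+ (2 * m) - 1 - (p%:Q - 1) * p%:Q ^+ m) /\
  (exists n2 : nat, n2%:Q = w2 /\
     (mult (F:=F) p m u n2)%:Q = (p%:Q - 1) * (p%:Q ^+ (m - 1) - p%:Q ^+ s + p%:Q ^+ (s - 1))) /\
  (exists n3 : nat, n3%:Q = w3 /\
     (mult (F:=F) p m u n3)%:Q = (p%:Q - 1) * (p%:Q ^+ s + 1) * (p%:Q ^+ s - p%:Q ^+ (s - 1))).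
Proof.
move=> p_pr p_odd m_gt0 m_even cardF u_gt0 s v mv w1 w2 w3.
have [j [l [mvE uE]]] := gcd_ratio u_gt0 mv.
have v_gt0 : (0 < v)%N by rewrite gcdn_gt0 u_gt0 orbT.
have sE : s = (v * j.*2.+1)%N by rewrite /s mvE doubleK.
have mE : m = s.*2 by rewrite sE -mvE.
have s_gt0 : (0 < s)%N by rewrite sE muln_gt0 v_gt0.
have natQ (n : nat) : n%:Q = n%:R by rewrite pmulrn.
pose A : rat := (p ^ s.-1)%:R.
have psQ : p%:Q ^+ s = p%:R * A by rewrite natQ -natrX -natrM -expnS prednK.
have ps1Q : p%:Q ^+ (s - 1) = A by rewrite natQ -natrX subn1.
have pmQ : p%:Q ^+ m = (p%:R * A) ^+ 2 by rewrite mE -muln2 exprM psQ.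
have pm1Q : p%:Q ^+ (m - 1) = p%:R * A ^+ 2.
  have -> : (m - 1 = s + (s - 1))%N by rewrite mE; lia.
  by rewrite exprD psQ ps1Q mulrA.
have p2mQ : p%:Q ^+ (2 * m) = (p%:R * A) ^+ 4 by rewrite mulnC exprM pmQ -exprM.
have p2m2Q : p%:Q ^+ (2 * m - 2) = (p%:R * A ^+ 2) ^+ 2.
  have -> : (2 * m - 2 = (m - 1) * 2)%N by lia.
  by rewrite exprM pm1Q.
rewrite /w1 /w2 /w3 psQ ps1Q pmQ pm1Q p2mQ p2m2Q !natQ.
have W1 := W_generic_rat p_pr v_gt0 sE mE.
have W2 := W_isotropic_rat p_pr p_odd v_gt0 sE mE uE cardF.
have W3 := W_anisotropic_rat p_pr p_odd v_gt0 sE mE uE cardF.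
do !split.
- move=> _ _ /imsetP[x _ ->] /imsetP[y _ ->]; rewrite cwD //.
  by apply/imsetP; exists (x.1 + y.1, x.2 + y.2).
- move=> k _ /imsetP[x _ ->]; rewrite cwMn //.
  by apply/imsetP; exists (x.1 *+ k, x.2 *+ k).
- exact: (card_D1 p_pr p_odd v_gt0 sE mE uE cardF).
- exact: (card_code p_pr p_odd v_gt0 sE mE uE cardF).
- move=> c cC; rewrite natQ /=.
  have := wt_values p_pr p_odd v_gt0 sE mE uE cardF cC.
  by rewrite !inE => /or4P[]/eqP->; rewrite ?W1 ?W2 ?W3 eqxx ?orbT.
- exact: (mult0 p_pr p_odd v_gt0 sE mE uE cardF).
(* The three integer weights are p^(m-1) (p^m - t), for t = p^(m-1) here and for t = [goldfib 0] and
   [goldfib 1] in the next two goals. *)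
- exists (p ^ m.-1 * (p ^ m - p ^ m.-1))%N; rewrite !natQ; split=> //.
  exact: (mult_generic_rat p_pr p_odd v_gt0 sE mE uE cardF).
- eexists; rewrite !natQ; split; first exact: W2.
  exact: (mult_isotropic_rat p_pr p_odd v_gt0 sE mE uE cardF).
- eexists; rewrite !natQ; split; first exact: W3.
  exact: (mult_anisotropic_rat p_pr p_odd v_gt0 sE mE uE cardF).
Qed.
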